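(* Let $d,n_1,\dots,n_d$ be positive integers, $\Omega\subseteq\mathcal{G}=[n_1]\times\dots\times[n_d]$, and $\hat T\in\mathbb{R}^\Omega$, and suppose that the exact rank-one completion problem for $(\Omega,\hat T)$ has a unique solution. Assume that $\Omega$ satisfies SR-propagation and that the values $(\hat T_\alpha)_{\alpha\in\Omega}$ are all nonzero. Then the relaxation (SDP-E) is tight.
   Context: Notation: $[m]=\{1,\dots,m\}$; $N=n_1\cdots n_d$; $\mathcal{G}=[n_1]\times\dots\times[n_d]$; coordinates of $\mathbb{R}^N$ are indexed by $\mathcal{G}$, and $\mathbb{S}^N$ is the space of real symmetric $N\times N$ matrices (rows and columns indexed by $\mathcal{G}$). Exact rank-one completion problem for $(\Omega,\hat T)$: find a rank-one tensor $T\in\mathbb{R}^{n_1\times\dots\times n_d}$ (nonzero, of the form $T_{i_1,\dots,i_d}=\prod_k u^{(k)}_{i_k}$) with $T_\alpha=\hat T_\alpha$ for all $\alpha\in\Omega$. Square: $\{\alpha_1,\alpha_2;\alpha_3,\alpha_4\}$ is a square if $\alpha_1,\dots,\alpha_4\in\mathcal{G}$ are distinct and for every $k\in[d]$, $\max\{(\alpha_1)_k,(\alpha_2)_k\}=\max\{(\alpha_3)_k,(\alpha_4)_k\}$ and $\min\{(\alpha_1)_k,(\alpha_2)_k\}=\min\{(\alpha_3)_k,(\alpha_4)_k\}$. Let $\mathcal{A}$ be the set of all squares. SR-propagation: let $\mathcal{P}_{SR}(\Omega)$ be the smallest set containing $\Omega$ such that if $\{\alpha_1,\beta;\alpha_2,\gamma\}$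 is a square with $\alpha_1,\alpha_2\in\Omega$ and $\beta\in\mathcal{P}_{SR}(\Omega)$, then $\gamma\in\mathcal{P}_{SR}(\Omega)$. $\Omega$ satisfies SR-propagation if $\mathcal{P}_{SR}(\Omega)=\mathcal{G}$. (SDP-E): minimize $\operatorname{tr}(X)$ over $x\in\mathbb{R}^N$, $X\in\mathbb{S}^N$ subject to $x_\alpha=\hat T_\alpha$ and $X_{\alpha,\alpha}=\hat T_\alpha^2$ for all $\alpha\in\Omega$; $X_{\alpha_1,\alpha_2}=X_{\alpha_3,\alpha_4}$ for all $\{\alpha_1,\alpha_2;\alpha_3,\alpha_4\}\in\mathcal{A}$; and $\mathbf{X}:=\begin{pmatrix}1 & x^T \\ x & X\end{pmatrix}\succeq0$. Tight: let $T$ be the unique completion and $\bar x\in\mathbb{R}^N$ the vector with $\bar x_\beta=T_\beta$. (SDP-E) is tight if it has a unique optimal solution, namely the rank-one matrix $\bar{\mathbf{X}}=\begin{pmatrix}1 & \bar x^T \\ \bar x & \bar x\bar x^T\end{pmatrix}$. *)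

(* Defs.v *)
From mathcomp Require Import all_boot all_order all_algebra.
From mathcomp Require Import reals.

Set Implicit Arguments.
Unset Strict Implicit.
Unset Printing Implicit Defensive.

Import Order.TTheory GRing.Theory Num.Theory.

Local Open Scope ring_scope.

(* The index set [n_1] x ... x [n_d]; both the d modes and the entries of each
   mode are numbered from 0. *)
Definition grid d (n : 'I_d -> nat) : finType :=
  {dffun forall k : 'I_d, 'I_(n k)}.

Definition dimN d (n : 'I_d -> nat) : nat := #|grid n|.

Lemma dimNE d (n : 'I_d -> nat) : dimN n = (\prod_(k < d) n k)%N.
Proof.
by rewrite /dimN /grid card_dep_ffun foldrE big_map big_enum /=; apply: eq_bigr => k _; rewrite card_ord.
Qed.

(* is_square a1 a2 a3 a4 reads {a1, a2; a3, a4}. *)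
Definition is_square d (n : 'I_d -> nat) (a1 a2 a3 a4 : grid n) : bool :=
  uniq [:: a1; a2; a3; a4] &&
  [forall k, (maxn (a1 k) (a2 k) == maxn (a3 k) (a4 k)) &&
             (minn (a1 k) (a2 k) == minn (a3 k) (a4 k))].

(* The hypothesis in SR_step asks that a1 and a2, which lie on opposite sides
   of the semicolon, both be in Omega itself, not merely in its closure. *)
Inductive SR_closure d (n : 'I_d -> nat) (Omega : {set grid n}) :
  grid n -> Prop :=
| SR_base a : a \in Omega -> SR_closure Omega a
| SR_step a1 b a2 c : is_square a1 b a2 c ->
    a1 \in Omega -> a2 \in Omega -> SR_closure Omega b -> SR_closure Omega c.

Definition SR_propagation d (n : 'I_d -> nat) (Omega : {set grid n}) : Prop :=
  forall a : grid n, SR_closure Omega a.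

Definition tensor (R : realType) d (n : 'I_d -> nat) : Type :=
  {ffun grid n -> R}.

Definition observations (R : realType) d (n : 'I_d -> nat)
    (Omega : {set grid n}) : Type :=
  {ffun {a : grid n | a \in Omega} -> R}.

Definition rank_one (R : realType) d (n : 'I_d -> nat) (T : tensor R n) :
    Prop :=
  (exists a, T a != 0) /\
  exists u : forall k : 'I_d, 'I_(n k) -> R,
    forall a, T a = \prod_(k < d) u k (a k).

Definition rank_one_completion (R : realType) d (n : 'I_d -> nat)
    (Omega : {set grid n}) (That : observations R Omega) (T : tensor R n) :
    Prop :=
  rank_one T /\ forall a : {a : grid n | a \in Omega}, T (val a) = That a.

(* R^N and the N x N matrices are indexed by 'I_N, identified with the grid
   through enum_rank / enum_val; the next two definitions read off entries at
   grid positions. *)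
Definition vget (R : realType) d (n : 'I_d -> nat)
    (x : 'cV[R]_(dimN n)) (a : grid n) : R := x (enum_rank a) 0.

Definition mget (R : realType) d (n : 'I_d -> nat)
    (X : 'M[R]_(dimN n)) (a b : grid n) : R := X (enum_rank a) (enum_rank b).

Definition vectorize (R : realType) d (n : 'I_d -> nat) (T : tensor R n) :
    'cV[R]_(dimN n) := \col_i T (enum_val i).

Definition psdmx (R : realType) m (A : 'M[R]_m) : Prop :=
  A \is symmetricmx /\ forall v : 'cV[R]_m, 0 <= (v^T *m A *m v) 0 0.

Definition bordered (R : realType) m (x : 'cV[R]_m) (X : 'M[R]_m) :
    'M[R]_(1 + m) := block_mx 1%:M x^T x X.

Definition sdpe_feasible (R : realType) d (n : 'I_d -> nat)
    (Omega : {set grid n}) (That : observations R Omega)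
    (x : 'cV[R]_(dimN n)) (X : 'M[R]_(dimN n)) : Prop :=
  [/\ X \is symmetricmx,
      forall a : {a : grid n | a \in Omega},
        vget x (val a) = That a /\ mget X (val a) (val a) = That a ^+ 2,
      forall a1 a2 a3 a4 : grid n, is_square a1 a2 a3 a4 ->
        mget X a1 a2 = mget X a3 a4
    & psdmx (bordered x X)].

Definition sdpe_optimal (R : realType) d (n : 'I_d -> nat)
    (Omega : {set grid n}) (That : observations R Omega)
    (x : 'cV[R]_(dimN n)) (X : 'M[R]_(dimN n)) : Prop :=
  sdpe_feasible That x X /\
  forall x' X', sdpe_feasible That x' X' -> \tr X <= \tr X'.

Definition sdpe_tight (R : realType) d (n : 'I_d -> nat)
    (Omega : {set grid n}) (That : observations R Omega) : Prop :=
  exists T : tensor R n,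
    unique (rank_one_completion That) T /\
    let xbar := vectorize T in
    let Xbar := xbar *m xbar^T in
    sdpe_optimal That xbar Xbar /\
    forall x X, sdpe_optimal That x X -> bordered x X = bordered xbar Xbar.

(* Main.v *)
Require Import Defs.
From mathcomp Require Import all_boot all_order all_algebra.
From mathcomp Require Import reals.
From mathcomp Require Import ring.

(** The argument has two halves, both read off from the Schur complement
    [S = X - x x^T] of a feasible point [(x, X)], which is positive
    semidefinite because the bordered matrix is ([psdmx_bordered]).

    At an observed position [a] the constraints [x_a = T_a] and
    [X_aa = T_a ^ 2] give [S_aa = 0].  A zero on the diagonal of a positive
    semidefinite matrix kills its whole row ([psdmx_diag0_row]), so
    [X_ab = T_a x_b] for every [b] ([feasible_row]).  The constraint attached
    to a square [{a1, b; a2, c}] with [a1], [a2] observed thus becomes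
    [T_a1 x_b = T_a2 x_c].  The rank-one tensor [T] satisfies the same identity
    ([rank_one_square]) and [T_a2] is nonzero, so [x_b = T_b] forces
    [x_c = T_c]: the vector [x] follows [T] along the propagation, hence
    everywhere ([feasible_vectorize]).

    Every feasible point therefore has the form [(xbar, xbar xbar^T + S)] with
    [S] positive semidefinite.  Since [S = 0] is feasible and [\tr S >= 0], the
    minimum of the trace is reached at [S = 0], and nowhere else because a
    positive semidefinite matrix of trace zero vanishes
    ([psdmx_mxtrace0]). *)

Import Order.TTheory GRing.Theory Num.Theory.

Local Open Scope ring_scope.

Lemma symmetricmx_trE {R : realType} {m : nat} (A : 'M[R]_m) :
  (A \is symmetricmx) = (A == A^T).
Proof. by rewrite is_hermitianmxE expr0 scale1r map_mx_id. Qed.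

Lemma psdmx_sym {R : realType} {m : nat} {A : 'M[R]_m} (i j : 'I_m) :
  psdmx A -> A i j = A j i.
Proof.
by case; rewrite symmetricmx_trE => /eqP AE _; rewrite [in LHS]AE mxE.
Qed.

Lemma delta_form {R : realType} {m : nat} (A : 'M[R]_m) (i j : 'I_m) :
  (delta_mx i (0 : 'I_1))^T *m A *m delta_mx j 0 = (A i j)%:M :> 'M_1.
Proof.
rewrite trmx_delta -rowE -colE; apply/matrixP => p q.
by rewrite !ord1 !mxE eqxx.
Qed.

Lemma psdmx_diag_ge0 {R : realType} {m : nat} {A : 'M[R]_m} (i : 'I_m) :
  psdmx A -> 0 <= A i i.
Proof. by case=> _ /(_ (delta_mx i 0)); rewrite delta_form mxE. Qed.

(** The form takes the value [s ^+ 2 * A i i + 2 * s * A i j + A j j] at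
    [s e_i + e_j]; once [A i i = 0] this is affine in [s], and an affine
    function that is nonnegative everywhere has slope zero. *)
Lemma psdmx_diag0_row {R : realType} {m : nat} {A : 'M[R]_m} (i j : 'I_m) :
  psdmx A -> A i i = 0 -> A i j = 0.
Proof.
move=> psdA Aii0; apply/eqP/negPn/negP => Aij_neq0.
have Aji : A j i = A i j by apply: psdmx_sym.
(* At this [s] the affine function takes the value -1. *)
pose s := - (A j j + 1) / (2 * A i j).
have := psdA.2 (s *: delta_mx i 0 + delta_mx j 0).
rewrite [_^T]linearP /= !(mulmxDl, mulmxDr) -!scalemxAl -!scalemxAr.
rewrite !delta_form !mxE Aii0 Aji /= !mulr1n.
have -> : s * (s * 0) + s * A i j + (s * A i j + A j j) = -1.
  by rewrite /s; field.
by rewrite lerNr oppr0 ler10.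
Qed.

Lemma psdmx_mxtrace_ge0 {R : realType} {m : nat} {A : 'M[R]_m} :
  psdmx A -> 0 <= \tr A.
Proof. by move=> psdA; apply: sumr_ge0 => i _; apply: psdmx_diag_ge0. Qed.

Lemma psdmx_mxtrace0 {R : realType} {m : nat} {A : 'M[R]_m} :
  psdmx A -> \tr A = 0 -> A = 0.
Proof.
move=> psdA /eqP; rewrite psumr_eq0 => [/allP trA0|i _]; last first.
  exact: psdmx_diag_ge0.
apply/matrixP => i j; rewrite mxE; apply: psdmx_diag0_row => //.
by apply/eqP/trA0; rewrite mem_index_enum.
Qed.

(** Completing the square in the form of the bordered matrix. *)
Lemma bordered_form {R : realType} {m : nat} (x : 'cV[R]_m) (X : 'M[R]_m)
    (t : 'M[R]_1) (z : 'cV[R]_m) :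
  (col_mx t z)^T *m bordered x X *m col_mx t z =
  (t + x^T *m z)^T *m (t + x^T *m z) + z^T *m (X - x *m x^T) *m z.
Proof.
rewrite /bordered tr_col_mx mul_row_block mul_row_col mulmx1.
rewrite [(t + _)^T]linearD /= trmx_mul trmxK !(mulmxDl, mulmxDr) mulmxN mulNmx.
rewrite !mulmxA -!addrA; congr (_ + _); rewrite addrCA; congr (_ + _).
by congr (_ + _); rewrite addrC subrK.
Qed.

(** Schur complement of the corner entry 1: by [bordered_form], choosing
    [t = - x^T z] removes the square and leaves the form of [X - x x^T]. *)
Lemma psdmx_bordered {R : realType} {m : nat} (x : 'cV[R]_m) (X : 'M[R]_m) :
  psdmx (bordered x X) <-> psdmx (X - x *m x^T).
Proof.
have symE : (bordered x X \is symmetricmx) = (X - x *m x^T \is symmetricmx).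
  rewrite !symmetricmx_trE linearB /= trmx_mul trmxK (inj_eq (addIr _)).
  rewrite tr_block_mx trmx1 trmxK; apply/eqP/eqP => [/eq_block_mx[]//|<- //].
rewrite /psdmx symE; split=> -[symX psdX]; split=> // v.
  have := psdX (col_mx (- (x^T *m v)) v).
  by rewrite bordered_form addNr mulmx0 add0r.
rewrite -[v]vsubmxK bordered_form mxE addr_ge0 //.
by rewrite mxE big_ord1 mxE -expr2 sqr_ge0.
Qed.

(** In each mode the two coordinates on one side of a square are those on the
    other side up to order, so the factors can be exchanged mode by mode. *)
Lemma rank_one_square {R : realType} {d : nat} {n : 'I_d -> nat}
    {T : tensor R n} {a1 a2 a3 a4 : grid n} :
  rank_one T -> is_square a1 a2 a3 a4 -> T a1 * T a2 = T a3 * T a4.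
Proof.
case=> _ [u Tu] /andP[_ /forallP sq]; rewrite !Tu -!big_split /=.
apply: eq_bigr => k _; have /andP[/eqP eq_max /eqP eq_min] := sq k.
have [[e1 e2]|[e1 e2]] : (a1 k = a3 k /\ a2 k = a4 k) \/
    (a1 k = a4 k /\ a2 k = a3 k).
- case: (leqP (a1 k) (a2 k)) eq_max eq_min => _;
    case: (leqP (a3 k) (a4 k)) => _ /= e1 e2;
    by [left; split; apply: val_inj | right; split; apply: val_inj].
- by rewrite e1 e2.
- by rewrite e1 e2 mulrC.
Qed.

Lemma vget_vectorize {R : realType} {d : nat} {n : 'I_d -> nat}
    (T : tensor R n) (a : grid n) : vget (vectorize T) a = T a.
Proof. by rewrite /vget mxE enum_rankK. Qed.

Lemma mget_outer {R : realType} {d : nat} {n : 'I_d -> nat}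
    (x : 'cV[R]_(dimN n)) (a b : grid n) :
  mget (x *m x^T) a b = vget x a * vget x b.
Proof. by rewrite /mget mxE big_ord1 mxE. Qed.

Lemma rank_one_feasible {R : realType} {d : nat} {n : 'I_d -> nat}
    {Omega : {set grid n}} {That : observations R Omega} {T : tensor R n} :
  rank_one_completion That T ->
  sdpe_feasible That (vectorize T) (vectorize T *m (vectorize T)^T).
Proof.
move=> [T1 TOmega]; split.
- by rewrite symmetricmx_trE trmx_mul trmxK.
- by move=> a; rewrite mget_outer vget_vectorize TOmega expr2.
- move=> a1 a2 a3 a4 sq; rewrite !mget_outer !vget_vectorize.
  exact: rank_one_square.
- apply/psdmx_bordered; rewrite subrr; split.
    by rewrite symmetricmx_trE linear0.
  by move=> v; rewrite mulmx0 mul0mx mxE.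
Qed.

(** The Schur complement has the diagonal entry [T_a ^ 2 - T_a ^ 2 = 0] at an
    observed position [a], hence a zero row there. *)
Lemma feasible_row {R : realType} {d : nat} {n : 'I_d -> nat}
    {Omega : {set grid n}} {That : observations R Omega}
    {x : 'cV[R]_(dimN n)} {X : 'M[R]_(dimN n)} (a b : grid n) :
  sdpe_feasible That x X -> a \in Omega -> mget X a b = vget x a * vget x b.
Proof.
case=> _ obs _ /psdmx_bordered psdS Omega_a.
have [xa Xaa] := obs (exist _ a Omega_a).
have SE c : (X - x *m x^T) (enum_rank a) (enum_rank c) =
    mget X a c - vget x a * vget x c by rewrite -mget_outer /mget !mxE.
apply/eqP; rewrite -subr_eq0 -SE; apply/eqP/psdmx_diag0_row => //.
by rewrite SE Xaa xa /= expr2 subrr.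
Qed.

(** By [feasible_row] and [rank_one_square], the constraint of a propagation
    step reads [T_a2 x_c = T_a1 x_b = T_a1 T_b = T_a2 T_c]; cancelling the
    observed value [T_a2] is where its nonvanishing enters. *)
Lemma feasible_vectorize {R : realType} {d : nat} {n : 'I_d -> nat}
    {Omega : {set grid n}} {That : observations R Omega} {T : tensor R n}
    {x : 'cV[R]_(dimN n)} {X : 'M[R]_(dimN n)} :
  SR_propagation Omega -> (forall a, That a != 0) ->
  rank_one_completion That T -> sdpe_feasible That x X -> x = vectorize T.
Proof.
move=> SR That_neq0 [T1 TOmega] feas; have [_ obs sqX _] := feas.
have xT a : a \in Omega -> vget x a = T a.
  by move=> Oa; have [-> _] := obs (exist _ a Oa); rewrite -TOmega.
suff xE a : vget x a = T a.
  apply/matrixP => i j.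
  by rewrite ord1 -[i]enum_valK -!/(vget _ _) vget_vectorize.
elim: (SR a) => [{}a /xT //|a1 b a2 c sq Oa1 Oa2 _ xb].
have Ta2_neq0 : T a2 != 0.
  by rewrite (TOmega (exist _ a2 Oa2)) That_neq0.
apply: (mulfI Ta2_neq0); rewrite -(rank_one_square T1 sq) -xb -!xT //.
by rewrite -!(feasible_row _ _ feas) // (sqX _ _ _ _ sq).
Qed.

Theorem theorem3 (R : realType) (d : nat) (n : 'I_d -> nat)
    (d_gt0 : (0 < d)%N) (n_gt0 : forall k : 'I_d, (0 < n k)%N)
    (Omega : {set grid n}) (That : observations R Omega)
    (uniqT : exists! T : tensor R n, rank_one_completion That T)
    (SR : SR_propagation Omega)
    (That_neq0 : forall a : {a : grid n | a \in Omega}, That a != 0) :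
  sdpe_tight That.
Proof.
have [T T_unique] := uniqT; have [T_completes _] := T_unique.
exists T; split=> //=; set xbar := vectorize T.
have feas_bar := rank_one_feasible T_completes.
have feasE x X : sdpe_feasible That x X ->
    x = xbar /\ psdmx (X - xbar *m xbar^T).
  move=> feas; have xE := feasible_vectorize SR That_neq0 T_completes feas.
  by case: feas => _ _ _ /psdmx_bordered; rewrite xE.
split=> [|x X [feas opt]].
  split=> // x' X' /feasE[_ /psdmx_mxtrace_ge0].
  by rewrite linearB /= subr_ge0.
have [-> psdS] := feasE x X feas; congr bordered.
apply/eqP; rewrite -subr_eq0; apply/eqP/psdmx_mxtrace0 => //.
apply/eqP; rewrite eq_le psdmx_mxtrace_ge0 // andbT.
by rewrite linearB /= subr_le0; exact: opt feas_bar.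
Qed.
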